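(* Let $\mathcal{H}$ be a real Hilbert space, let $\alpha,\beta\in\mathbb{R}$ with $\alpha+\beta\ge 0$, and let $A,B:\mathcal{H}\rightrightarrows\mathcal{H}$ be maximally $\alpha$-comonotone and maximally $\beta$-comonotone, respectively, with $\operatorname{zer}(A+B)\ne\varnothing$. Let $(\gamma,\delta,\lambda,\mu)\in\mathbb{R}_{++}^4$ satisfy $$(\lambda-1)(\mu-1)=1\quad\text{and}\quad\delta=(\lambda-1)\gamma,$$ and suppose that $$\gamma+\delta\le\min\{2(\gamma+\alpha),2(\delta+\beta)\}.$$ Let $\kappa\in\left]0,\overline{\kappa}\right[$, where $$\overline{\kappa}:=\begin{cases}1, & \text{if }\alpha+\beta=0,\\ \dfrac{4(\gamma+\alpha)(\delta+\beta)-(\gamma+\delta)^2}{2(\gamma+\delta)(\alpha+\beta)}, & \text{if }\alpha+\beta>0.\end{cases}$$ Let $x_0\in\mathcal{H}$ be an arbitrary starting point and let $(x_k)_{k=0}^{\infty}$ be generated by $x_{k+1}=T_{\mathrm{aDR}}(x_k)$, $k=0,1,2,\ldots$, where $T_{\mathrm{aDR}}$ is the adaptive Douglas--Rachford operator associated with $A,B,\gamma,\delta,\lambda,\mu,\kappa$, and let $J_1=J_{\gamma A}$. Then the shadow sequence $(J_1(x_k))_{k=0}^{\infty}$ converges weakly: $$J_1(x_k)\rightharpoonup J_1(x^\star)\in\operatorname{zer}(A+B),$$ where $x^\star\in\operatorname{Fix}T_{\mathrm{aDR}}$ is the weak limit of $(x_k)_{k=0}^{\infty}$.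
   Context: $\mathbb{R}_{++}=\{r\in\mathbb{R}:r>0\}$; $\rightharpoonup$ denotes weak convergence; $\operatorname{Id}$ is the identity on $\mathcal{H}$. For a set-valued operator $A:\mathcal{H}\rightrightarrows\mathcal{H}$: $\operatorname{gra}A=\{(x,u):u\in A(x)\}$, $\operatorname{zer}A=\{x:0\in A(x)\}$, $\operatorname{Fix}A=\{x:x\in A(x)\}$. For $\alpha\in\mathbb{R}$, $A$ is $\alpha$-comonotone if $\langle x-y,u-v\rangle\ge\alpha\|u-v\|^2$ for all $(x,u),(y,v)\in\operatorname{gra}A$; it is maximally $\alpha$-comonotone if moreover there is no $\alpha$-comonotone operator whose graph properly contains $\operatorname{gra}A$. The resolvent of $A$ is $J_A:=(\operatorname{Id}+A)^{-1}$. Given $(\gamma,\delta,\lambda,\mu,\kappa)\in\mathbb{R}_{++}^5$, set $$J_1:=J_{\gamma A},\quad R_1:=(1-\lambda)\operatorname{Id}+\lambda J_1,\quad J_2:=J_{\delta B},\quad R_2:=(1-\mu)\operatorname{Id}+\mu J_2.$$ The adaptive Douglas--Rachford operator is $T_{\mathrm{aDR}}:=(1-\kappa)\operatorname{Id}+\kappa R_2R_1$. Under the hypotheses of the claim, it is known that $\gamma+\alpha>0$ and $\delta+\beta>0$, that $J_1$ and $J_2$ (hence $T_{\mathrm{aDR}}$) are single-valued with full domain $\mathcal{H}$, and that $(x_k)$ converges weakly to a point $x^\star\in\operatorname{Fix}T_{\mathrm{aDR}}$ with $J_1(x^\star)\in\operatorname{zer}(A+B)$; this $x^\star$ is the one in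 the claim. *)

(* Defs.v *)
From HB Require Import structures.
From mathcomp Require Import all_boot all_order all_algebra.
From mathcomp Require Import all_classical all_reals all_analysis.

Set Implicit Arguments.
Unset Strict Implicit.
Unset Printing Implicit Defensive.

Import Order.TTheory GRing.Theory Num.Theory.
Import numFieldNormedType.Exports.

Local Open Scope classical_set_scope.
Local Open Scope ring_scope.

(* A real Hilbert space is a complete normed module H over R : realType with
   an inner product ip : {dot H for idfun} (bilinear, symmetric, positive
   definite) such that ip x x = `|x| ^+ 2.  Set-valued operators on H are
   functions H -> set H. *)

Section Operators.
Variables (R : realType) (H : completeNormedModType R).
Implicit Types (A B : H -> set H) (f g : H -> H).

Definition gra A : set (H * H) := [set p | A p.1 p.2].

Definition zer A : set H := [set x | A x 0].

Definition Fix A : set H := [set x | A x x].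

Definition op_of f : H -> set H := fun x => [set f x].

Definition add_op A B : H -> set H :=
  fun x => [set u + v | u in A x & v in B x].

Definition scale_op (c : R) A : H -> set H := fun x => [set c *: u | u in A x].

Definition inv_op A : H -> set H := fun u => [set x | A x u].

Definition resolvent A : H -> set H := inv_op (add_op (op_of id) A).

(* The function x |-> y associated with an operator A such that A x = [set y]
   for every x; arbitrary (some element of A x, or 0) where A is not
   single-valued. *)
Definition fun_of A : H -> H := fun x => xget 0 (A x).

Definition relax (c : R) f : H -> H := fun x => (1 - c) *: x + c *: f x.

Definition J_ (c : R) A : H -> H := fun_of (resolvent (scale_op c A)).

Definition T_aDR A B (gamma delta lambda mu kappa : R) : H -> H :=
  let R1 := relax lambda (J_ gamma A) in
  let R2 := relax mu (J_ delta B) in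
  relax kappa (R2 \o R1).

Variable ip : {dot H for idfun}.

Definition comonotone (alpha : R) A : Prop :=
  forall x u y v, gra A (x, u) -> gra A (y, v) ->
    ip (x - y) (u - v) >= alpha * `|u - v| ^+ 2.

Definition max_comonotone (alpha : R) A : Prop :=
  comonotone alpha A /\
  ~ (exists B, comonotone alpha B /\ gra A `<` gra B).

Definition weak_cvg (u : nat -> H) (l : H) : Prop :=
  forall y, ip (u k) y @[k --> \oo] --> ip l y.

End Operators.

Definition kappa_bar (R : realType) (alpha beta gamma delta : R) : R :=
  if alpha + beta == 0 then 1
  else (4 * (gamma + alpha) * (delta + beta) - (gamma + delta) ^+ 2)
       / (2 * (gamma + delta) * (alpha + beta)).

(* Main.v *)
Require Import Defs.
From HB Require Import structures.
From mathcomp Require Import all_boot all_order all_algebra.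
From mathcomp Require Import all_classical all_reals all_analysis.
From mathcomp Require Import ring lra.

Set Implicit Arguments.
Unset Strict Implicit.
Unset Printing Implicit Defensive.

Import Order.TTheory GRing.Theory Num.Theory.
Import numFieldNormedType.Exports.

Local Open Scope classical_set_scope.
Local Open Scope ring_scope.

(* Minty's theorem makes the resolvents total: the graph of a monotone operator
   lies in its bipolar for the bilinear form defining monotonicity, a convex set
   which is still monotone, and maximizing a strongly concave function on it
   gives the required point.  Write T_aDR = Id - kappa W with W = mu (J1 - J2 R1).
   Comonotonicity of A and B at two points, after completing a square, says that
   W is (kappa_bar / 2)-cocoercive, so the iterates converge weakly to a zero
   x* of W and W x_k -> 0 strongly.  For the shadows, put
   u_k = (x_k - J1 x_k) / gamma.  When the comonotonicity inequalities for A and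
   B are added, the only terms not weakly continuous in u_k are
   - (alpha + beta) |u_k|^2, so the sum passes to a weak cluster point p of
   (u_k); tested at J1 x* and at the resolvent of B at the limit, it reads
   (gamma + alpha) |p - u*|^2 + (delta + beta) |p + v'|^2 <= 0. *)

(** * Inner product calculus and strongly concave maximization *)

Section InnerProduct.
Variables (R : realType) (H : completeNormedModType R) (ip : {dot H for idfun}).
Hypothesis ip_norm : forall x : H, ip x x = `|x| ^+ 2.

Lemma ipC x y : ip x y = ip y x.
Proof. by rewrite hermC /= expr0 mul1r. Qed.

Lemma ipE :
  (((forall x y z, ip (x + y)%R z = (ip x z + ip y z)%R) *
    (forall x z, ip (- x)%R z = (- ip x z)%R) *
    (forall c x z, ip (c *: x)%R z = (c * ip x z)%R)) *
   ((forall x y z, ip z (x + y)%R = (ip z x + ip z y)%R) *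
    (forall x z, ip z (- x)%R = (- ip z x)%R) *
    (forall c x z, ip z (c *: x)%R = (c * ip z x)%R)))%type.
Proof.
do !split=> *; rewrite ?(linearDl, linearNl, linearZl_LR) //.
- by rewrite linearDr.
- by rewrite linearNr.
- by rewrite linearZr.
Qed.

Lemma ip0l z : ip 0 z = 0. Proof. exact: linear0l. Qed.

Lemma ip_ge0 x : 0 <= ip x x.
Proof. by rewrite ip_norm exprn_ge0. Qed.

Lemma ip_eq0 x : ip x x <= 0 -> x = 0.
Proof.
move=> xx; apply/eqP; rewrite -normr_eq0 -sqrf_eq0 -ip_norm.
by rewrite eq_le xx ip_ge0.
Qed.

(** Reduces a vector identity to a scalar one, within reach of [ring], [field] or [lra] after
    expansion by [ipE]. *)
Lemma ip_inj x y : (forall z, ip x z = ip y z) -> x = y.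
Proof.
move=> xy; apply/eqP; rewrite -subr_eq0; apply/eqP/ip_eq0.
by rewrite linearBl /= xy subrr.
Qed.

Lemma cauchy_schwarz x y : `|ip x y| <= `|x| * `|y|.
Proof.
have h u v : ip u v <= `|u| * `|v|.
  have := ler_normD u v; have := lerB_dist u (- v); rewrite normrN opprK.
  have := ip_norm (u + v); have := ip_norm u; have := ip_norm v.
  rewrite !ipE (ipC v u).
  have := normr_ge0 (u + v); have := normr_ge0 u; have := normr_ge0 v.
  nra.
by rewrite ler_norml h andbT lerNl -(linearNl ip y) -(normrN x) h.
Qed.

Lemma cvg_ip (u : nat -> H) l y :
  u n @[n --> \oo] --> l -> ip (u n) y @[n --> \oo] --> ip l y.
Proof.
move=> ul; apply/cvgrPdist_le => e e0.
have d0 : 0 < e / (`|y| + 1) by rewrite divr_gt0 // ltr_wpDl.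
have /cvgrPdist_le/(_ _ d0) := ul; apply: filterS => n h.
rewrite -(linearBl ip y); apply: (le_trans (cauchy_schwarz _ _)).
rewrite ler_pdivlMr ?ltr_wpDl// in h; apply: le_trans h.
by rewrite ler_wpM2l // lerDl.
Qed.

Lemma cvg_ip_sqr (u : nat -> H) l b :
  u n @[n --> \oo] --> l ->
  ip (b - u n) (b - u n) @[n --> \oo] --> ip (b - l) (b - l).
Proof.
move=> ul; rewrite ip_norm; under eq_fun do rewrite ip_norm expr2.
rewrite expr2; have h : `|b - u n| @[n --> \oo] --> `|b - l|.
  by apply: cvg_norm; apply: cvgB ul; apply: cvg_cst.
exact: cvgM.
Qed.

Lemma ip_complete (u : nat -> H) (e : nat -> R) :
  (forall n m, (n <= m)%N -> ip (u n - u m) (u n - u m) <= e n) ->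
  e n @[n --> \oo] --> 0 -> exists l : H, u n @[n --> \oo] --> l.
Proof.
move=> ue e0; apply/cvg_ex/cauchy_cvgP/cauchy_exP => d d0.
have [N _ /(_ N (leqnn _)) eN] := cvgr_lt _ e0 _ (exprn_gt0 2 d0).
exists (u N); exists N => // m /= /ue um.
rewrite /= -ball_normE /=.
rewrite -(@ltr_pXn2r _ 2) ?nnegrE ?(ltW d0)// -ip_norm.
exact: le_lt_trans um eN.
Qed.

(** The function p.2 - |p.1|^2 is strongly concave and at most 0 on K. The first components of a
    maximizing sequence converge to u, and first-order optimality in the limit is the inequality. *)
Lemma convex_minimax (K : set (H * R)) :
  (forall p q (t : R), 0 <= t <= 1 -> K p -> K q ->
     K (p.1 + t *: (q.1 - p.1), p.2 + t * (q.2 - p.2))) ->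
  (forall p, K p -> p.2 <= ip p.1 p.1) ->
  exists u, forall p, K p -> ip u u - 2 * ip u p.1 + p.2 <= 0.
Proof.
move=> Kconv Kle; have [K0|/set0P Kn] := eqVneq K set0.
  by exists 0 => p; rewrite K0.
pose g (p : H * R) := p.2 - ip p.1 p.1; pose s := sup (g @` K).
have gub : ubound (g @` K) 0 by move=> _ [p /Kle Kp <-]; rewrite subr_le0.
have gn : g @` K !=set0 by case: Kn => p Kp; exists (g p), p.
have gs p : K p -> g p <= s by move=> Kp; apply: ub_le_sup; [exists 0 | exists p].
have s0 : s <= 0 by apply: ge_sup.
have /choice [p pP] n : exists p, K p /\ s - harmonic n < g p.
  have gsup : has_sup (g @` K) by split=> //; exists 0.
  have [_ [p Kp <-] ?] := sup_adherent (harmonic_gt0 n) gsup.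
  by exists p.
have h0 : (4 * @harmonic R n) @[n --> \oo] --> 0.
  by rewrite -[X in _ --> X](mulr0 4); apply: cvgMl_tmp; apply: cvg_harmonic.
(* At the midpoint, strong concavity bounds a quarter of the squared distance by s minus the mean of
   the two values of g, hence by [harmonic n]. *)
have [|u pu] := @ip_complete (fun n => (p n).1) _ _ h0.
  move=> n m nm; have [Kn1 gn1] := pP n; have [Km gm] := pP m.
  have hmn : @harmonic R m <= harmonic n by rewrite /= lef_pV2 ?posrE// ler_nat.
  have t01 : 0 <= (2^-1 : R) <= 1 by lra.
  have := gs _ (Kconv _ _ 2^-1 t01 Kn1 Km).
  move: gn1 gm; rewrite /g /= !ipE (ipC (p m).1 (p n).1).
  move: hmn => /=; move: (_.+1%:R^-1) (m.+1%:R^-1) => r r1; lra.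
exists u => q Kq.
set L := (X in X <= 0); pose D := ip (q.1 - u) (q.1 - u).
have LD : L = q.2 + D - ip q.1 q.1 by rewrite /L /D !ipE (ipC q.1 u); ring.
have D0 : 0 <= D by apply: ip_ge0.
(* The value of g at parameter t on the segment from [p n] to q is at most s; let n tend to
   infinity. *)
have key (t : R) : 0 < t -> t <= 1 -> t * L <= t ^+ 2 * D.
  move=> t0 t1; have Dn := cvg_ip_sqr (b := q.1) pu; rewrite -/D in Dn.
  pose d n := ip (q.1 - (p n).1) (q.1 - (p n).1).
  have F1 : t * (q.2 + d n - ip q.1 q.1) @[n --> \oo] --> t * L.
    rewrite LD; apply: cvgMl_tmp.
    by apply: cvgB; [apply: cvgD => //; exact: cvg_cst | exact: cvg_cst].
  have F2 : harmonic n + t ^+ 2 * d n @[n --> \oo] --> 0 + t ^+ 2 * D.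
    by apply: cvgD; [exact: cvg_harmonic | apply: cvgMl_tmp].
  rewrite -[X in _ <= X]add0r; apply: (ler_cvg_to F1 F2); apply: nearW => n.
  rewrite /d; have [Kp gp] := pP n.
  have t01 : 0 <= t <= 1 by rewrite ltW.
  have := gs _ (Kconv _ _ t t01 Kp Kq); have := harmonic_gt0 (R := R) n.
  move: gp; rewrite /g !ipE (ipC q.1 (p n).1) /=.
  move: (_.+1%:R^-1) => r; nra.
rewrite leNgt; apply/negP => L0.
(* This t satisfies t D < L, which contradicts [key]. *)
have t0 : 0 < L / (L + D + 1) by rewrite divr_gt0//; lra.
have t1 : L / (L + D + 1) <= 1 by rewrite ler_pdivrMr ?mul1r; lra.
have := key _ t0 t1; rewrite expr2 -mulrA ler_pM2l // mulrAC ler_pdivlMr; last lra.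
nra.
Qed.

End InnerProduct.

(** * Minty's theorem and resolvents of comonotone operators *)

Section Resolvent.
Variables (R : realType) (H : completeNormedModType R) (ip : {dot H for idfun}).
Hypothesis ip_norm : forall x : H, ip x x = `|x| ^+ 2.

(** On points lifted by [graph], [Q] is <x - y, v - w>, yet it is affine in each argument, so polars
    are convex. Monotonicity puts the lifted G in its own polar; hence the bipolar lies in the polar
    and [Q e e] >= 0 on it. *)
Lemma debrunner_flor (G : set (H * H)) :
  (forall p q, G p -> G q -> 0 <= ip (p.1 - q.1) (p.2 - q.2)) ->
  exists u, forall p, G p -> 0 <= ip (u - p.1) (- u - p.2).
Proof.
move=> Gmon.
pose Q (e f : (H * H) * R) := e.2 + f.2 - ip e.1.1 f.1.2 - ip f.1.1 e.1.2.
pose graph (p : H * H) := (p, ip p.1 p.2).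
pose polar f := forall p, G p -> 0 <= Q f (graph p).
pose bipolar e := forall f, polar f -> 0 <= Q e f.
have graph_polar p : G p -> polar (graph p).
  move=> Gp q Gq; have := Gmon _ _ Gp Gq; rewrite /Q /= !(ipE ip); lra.
have graph_bipolar p : G p -> bipolar (graph p).
  by move=> Gp f /(_ p Gp); rewrite /Q /=; lra.
have bipolar_diag e : bipolar e -> ip e.1.1 e.1.2 <= e.2.
  move=> be; have : 0 <= Q e e by apply: (be) => p /graph_polar/be.
  by rewrite /Q; lra.
(* For ((x, v), r) in the bipolar, -r <= |x - v|^2 / 4 follows from [bipolar_diag] and |x + v|^2 >=
   0; at a lifted point of G the inequality for u is the claim. *)
pose K := [set (2^-1 *: (e.1.1 - e.1.2), - e.2) | e in bipolar].
have [||u uP] := @convex_minimax _ _ ip ip_norm K.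
- move=> _ _ t /andP[t0 t1] [e be <-] [f bf <-].
  exists ((e.1.1 + t *: (f.1.1 - e.1.1), e.1.2 + t *: (f.1.2 - e.1.2)),
          e.2 + t * (f.2 - e.2)).
    move=> g pg; have := be g pg; have := bf g pg.
    by rewrite /Q /= !(ipE ip); nra.
  congr (_, _); last by rewrite /=; ring.
  by apply: (ip_inj ip_norm) => z; rewrite /= !(ipE ip) /=; ring.
- move=> _ [e /bipolar_diag be <-] /=.
  have := ip_ge0 ip_norm (e.1.1 + e.1.2).
  by rewrite !(ipE ip) (ipC ip e.1.2 e.1.1); lra.
exists u => p Gp; have /uP : K (2^-1 *: (p.1 - p.2), - ip p.1 p.2).
  by exists (graph p) => //; apply: graph_bipolar.
by rewrite /= !(ipE ip) (ipC ip p.1 u); lra.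
Qed.

(** Here y - y' = - gamma (v - v'), so comonotonicity reads (gamma + alpha) |v - v'|^2 <= 0. *)
Lemma comonotone_inj (alpha gamma : R) (A : H -> set H) y v y' v' :
  comonotone ip alpha A -> 0 < gamma + alpha ->
  A y v -> A y' v' -> y + gamma *: v = y' + gamma *: v' -> y = y'.
Proof.
move=> Amon ga Av Av' e.
have yE : y - y' = - gamma *: (v - v').
  apply: (ip_inj ip_norm) => z; have := congr1 (ip^~ z) e.
  by rewrite /= !(ipE ip); lra.
have /ip_eq0 vv : ip (v - v') (v - v') <= 0.
  have := Amon _ _ _ _ Av Av'; rewrite yE (linearZl_LR ip) /= -ip_norm.
  by have := ip_ge0 ip_norm (v - v'); nra.
by apply/eqP; rewrite -subr_eq0 yE vv // scaler0.
Qed.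

(** The change of variables [m] turns alpha-comonotonicity into monotonicity of the pairs (v, m),
    and sends (x - gamma u, u) to -u. So [debrunner_flor] gives a pair comonotonically related to A,
    which maximality puts in its graph. *)
Lemma minty (alpha gamma : R) (A : H -> set H) x :
  max_comonotone ip alpha A -> 0 < gamma + alpha ->
  exists y v, A y v /\ x = y + gamma *: v.
Proof.
move=> [Amon Amax] ga.
pose m (p : H * H) := (gamma + alpha)^-1 *: (p.1 - alpha *: p.2 - x).
have [|u uP] := @debrunner_flor [set (p.2, m p) | p in gra A].
  move=> _ _ [[y v] Av <-] [[y' v'] Av' <-] /=.
  have := Amon _ _ _ _ Av Av'; rewrite -ip_norm -subr_ge0.
  rewrite (_ : _ - _ = (gamma + alpha) * ip (v - v') (m (y, v) - m (y', v'))).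
    by rewrite pmulr_rge0.
  rewrite /m /= !(ipE ip) !(ipC ip y) !(ipC ip y').
  by field; lra.
exists (x - gamma *: u), u; split; last by rewrite subrK.
apply: contrapT => nA; apply: Amax.
pose B y := A y `|` [set v | y = x - gamma *: u /\ v = u].
have key y v : A y v ->
    alpha * ip (u - v) (u - v) <= ip (x - gamma *: u - y) (u - v).
  move=> Av; have uv := uP (v, m (y, v)) (ex_intro2 _ _ (y, v) Av erefl).
  rewrite -subr_ge0.
  rewrite (_ : _ - _ = (gamma + alpha) * ip (u - v) (- u - m (y, v))).
    by rewrite mulr_ge0 // ltW.
  rewrite /m /= !(ipE ip) !(ipC ip y) !(ipC ip x) !(ipC ip v u).
  by field; lra.
exists B; split; last first.
  split=> [[y v]|/(_ (x - gamma *: u, u))]; first by left.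
  by apply/contra_not: nA; apply; right.
rewrite /comonotone /gra /= => y v y' v'.
move=> [Av|[-> ->]] [Av'|[-> ->]]; rewrite -?ip_norm.
- by rewrite ip_norm; exact: Amon.
- by have := key _ _ Av; rewrite !(ipE ip); lra.
- exact: key.
- by rewrite !subrr !(ip0l ip) mulr0.
Qed.

Lemma resolventP (gamma : R) (A : H -> set H) x y :
  resolvent (scale_op gamma A) x y <-> exists2 v, A y v & x = y + gamma *: v.
Proof.
split=> [[_ -> [_ [v Av <-] <-]]|[v Av ->]]; first by exists v.
by exists y => //; exists (gamma *: v) => //; exists v.
Qed.

Lemma J_P (alpha gamma : R) (A : H -> set H) x :
  max_comonotone ip alpha A -> 0 < gamma + alpha -> 0 < gamma ->
  A (J_ gamma A x) (gamma^-1 *: (x - J_ gamma A x)).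
Proof.
move=> Amax ga g0; have [y [v [Av xE]]] := minty x Amax ga.
have /resolventP[w Aw /eqP] : resolvent (scale_op gamma A) x (J_ gamma A x).
  (* The resolvent is nonempty by [minty], so [xget] does not fall back on its default 0. *)
  by apply: xgetI; apply/resolventP; exists v; first exact: Av.
by rewrite addrC -subr_eq => /eqP ->; rewrite scalerK // gt_eqF.
Qed.

Lemma J_eq (alpha gamma : R) (A : H -> set H) y v :
  max_comonotone ip alpha A -> 0 < gamma + alpha -> 0 < gamma -> A y v ->
  J_ gamma A (y + gamma *: v) = y.
Proof.
move=> Amax ga g0 Av; have Jv := J_P (y + gamma *: v) Amax ga g0.
apply: (comonotone_inj (proj1 Amax) ga Jv Av).
by rewrite scalerKV ?gt_eqF // addrC subrK.
Qed.

End Resolvent.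

(** * Weak cluster points and the Krasnoselskii-Mann iteration *)

Section WeakConvergence.
Variables (R : realType) (H : completeNormedModType R) (ip : {dot H for idfun}).
Hypothesis ip_norm : forall x : H, ip x x = `|x| ^+ 2.

Definition bounded_seq (x : nat -> H) := exists M : R, forall k, `|x k| <= M.

(* A weak cluster point of the subsequence indexed by S, in the dual form that
   every closed half-space eventually containing the subsequence contains p. *)
Definition weak_cluster (x : nat -> H) (S : set nat) (p : H) :=
  forall y c, (\forall k \near \oo, S k -> c <= ip (x k) y) -> c <= ip p y.

(** The sets [C n], cut out by the closed half-spaces containing a tail, decrease. Their nearly
    minimal-norm points form a Cauchy sequence, whose limit lies in every [C n]. *)
Lemma bounded_weak_cluster (x : nat -> H) (S : set nat) :
  bounded_seq x -> (forall n, exists2 k, (n <= k)%N & S k) ->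
  exists p, weak_cluster x S p.
Proof.
move=> [M xM] Sinf.
pose C n : set H := [set w | forall y c,
  (forall k, (n <= k)%N -> S k -> c <= ip (x k) y) -> c <= ip w y].
have Csub n m : (n <= m)%N -> C m `<=` C n.
  by move=> nm w Cw y c h; apply: Cw => k mk; apply: h; apply: leq_trans mk.
have Cmid n w w' : C n w -> C n w' -> C n (2^-1 *: (w + w')).
  move=> Cw Cw' y c h; have := Cw _ _ h; have := Cw' _ _ h.
  by rewrite !(ipE ip); lra.
pose sq n := [set ip w w | w in C n]; pose d n := inf (sq n).
have sqlb n : has_lbound (sq n) by exists 0 => _ [w _ <-]; exact: (ip_ge0 ip_norm).
have Cx n : exists2 k, C n (x k) & S k.
  by have [k nk Sk] := Sinf n; exists k => // y c; apply.
have sqn n : sq n !=set0 by have [k Ck _] := Cx n; exists (ip (x k) (x k)), (x k).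
have dle n w : C n w -> d n <= ip w w by move=> Cw; apply: ge_inf => //; exists w.
have dhomo n m : (n <= m)%N -> d n <= d m.
  by move=> /Csub nm; apply: lb_le_inf => // _ [w /nm/dle dw <-].
have dcvg : cvgn d.
  apply: nondecreasing_is_cvgn => //; exists (M ^+ 2) => _ [n _ <-].
  have [k Ck _] := Cx n; apply: (le_trans (dle _ _ Ck)).
  by rewrite ip_norm ler_pXn2r ?nnegrE ?xM // (le_trans _ (xM k)).
have /choice[w wP] n : exists w, C n w /\ ip w w < d n + harmonic n.
  have [_ [w Cw <-] ?] := inf_adherent (harmonic_gt0 n) (conj (sqn n) (sqlb n)).
  by exists w.
(* Parallelogram identity for w n and w m: their midpoint lies in [C n], so its squared norm is at
   least [d n]. *)
pose e n : R := 2 * (limn d - d n) + 4 * harmonic n.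
have e0 : e n @[n --> \oo] --> 0.
  rewrite (_ : 0 = 2 * (limn d - limn d) + 4 * 0); last first.
    by rewrite subrr !mulr0 addr0.
  apply: cvgD; apply: cvgMl_tmp; last exact: cvg_harmonic.
  by apply: cvgB => //; apply: cvg_cst.
have [|p wp] := ip_complete ip_norm _ e0 (u := w).
  move=> n m nm; have [Cn wn] := wP n; have [Cm wm] := wP m.
  have := dle _ _ (Cmid _ _ _ Cn (Csub _ _ nm _ Cm)).
  have := nondecreasing_cvgn_le dhomo dcvg m.
  have : @harmonic R m <= harmonic n by rewrite /= lef_pV2 ?posrE// ler_nat.
  move: wn wm; rewrite /e !(ipE ip) (ipC ip (w m) (w n)).
  by move: (harmonic n) (harmonic m) => r r'; lra.
exists p => y c [N _ hN].
have /cvg_lim <- // := cvg_ip ip_norm (y := y) wp.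
apply: limr_ge; first by apply/cvg_ex; exists (ip p y); exact: (cvg_ip ip_norm).
exists N => // n /= Nn; have [Cw _] := wP n.
by apply: (Csub _ _ Nn _ Cw) => k Nk; apply: hN.
Qed.

Lemma weak_cluster_le (x : nat -> H) (S : set nat) p y (f : nat -> R) c :
  weak_cluster x S p -> f k @[k --> \oo] --> c ->
  (forall k, f k <= ip (x k) y) -> c <= ip p y.
Proof.
move=> xp fc fx; apply/ler_addgt0Pr => e e0.
rewrite -lerBlDr; apply: xp.
have /cvgrPdist_le/(_ _ e0) := fc; apply: filterS => k /= ck _.
by apply: le_trans (fx k); move: ck; rewrite ler_norml; lra.
Qed.

Lemma weak_cluster_lim (x : nat -> H) (S : set nat) p y c :
  weak_cluster x S p -> ip (x k) y @[k --> \oo] --> c -> ip p y = c.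
Proof.
move=> xp xc; apply/eqP; rewrite eq_le (weak_cluster_le xp xc) // andbT.
have xcN : - ip (x k) y @[k --> \oo] --> - c by exact: cvgN.
have := weak_cluster_le (y := - y) xp xcN; rewrite (ipE ip) lerN2; apply=> k.
by rewrite (ipE ip).
Qed.

(** If a half-space test at l fails infinitely often, the failing indices have a weak cluster point,
    which violates the same test and so is not l. Testing y and -y gives both bounds. *)
Lemma weak_cvg_cluster (x : nat -> H) l : bounded_seq x ->
  (forall S p, (forall n, exists2 k, (n <= k)%N & S k) -> weak_cluster x S p ->
     p = l) ->
  weak_cvg ip x l.
Proof.
move=> xb xl.
have half y e : 0 < e -> \forall k \near \oo, ip l y - e <= ip (x k) y.
  move=> e0; apply: contrapT => nnear.
  pose S k := ip (x k) y < ip l y - e.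
  have Sinf n : exists2 k, (n <= k)%N & S k.
    apply: contrapT => nS; apply: nnear; exists n => // k /= nk.
    by rewrite leNgt; apply/negP => Sk; apply: nS; exists k.
  have [p xp] := bounded_weak_cluster xb Sinf.
  have : e - ip l y <= ip p (- y).
    by apply: xp; apply: nearW => k; rewrite /S (ipE ip); lra.
  by rewrite (xl _ _ Sinf xp) (ipE ip); lra.
move=> y; apply/cvgrPdist_le => e e0; near=> k.
have h1 : ip l y - e <= ip (x k) y by near: k; exact: half.
have h2 : ip l (- y) - e <= ip (x k) (- y) by near: k; exact: half.
by rewrite ler_norml; move: h1 h2; rewrite !(ipE ip); lra.
Unshelve. all: by end_near. Qed.

Lemma cvg0_ip_bounded (a b : nat -> H) :
  bounded_seq a -> ip (b k) (b k) @[k --> \oo] --> 0 ->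
  ip (a k) (b k) @[k --> \oo] --> 0.
Proof.
move=> [M aM] b0; have M0 : 0 <= M by apply: le_trans (aM 0%N).
apply/cvgrPdist_le => e e0.
have d0 : 0 < e / (M + 1) by rewrite divr_gt0 // ltr_wpDl.
have [N _ bN] := cvgr_lt _ b0 _ (exprn_gt0 2 d0); exists N => // k /= /bN.
rewrite ip_norm ltr_pXn2r ?nnegrE ?(ltW d0) // ltr_pdivlMr ?ltr_wpDl // => bk.
rewrite sub0r normrN; apply: (le_trans (cauchy_schwarz ip_norm _ _)).
have := aM k; have := normr_ge0 (a k); have := normr_ge0 (b k); nra.
Qed.

(* Opial's argument: all weak cluster points are zeros of W, and a sequence
   which is Fejer monotone with respect to the zeros has at most one such weak
   cluster point. *)
Lemma krasnoselskii_mann (W : H -> H) (c kappa : R) (x : nat -> H) z0 :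
  (forall y z, c * ip (W y - W z) (W y - W z) <= ip (y - z) (W y - W z)) ->
  0 < kappa < 2 * c -> W z0 = 0 ->
  (forall k, x k.+1 = x k - kappa *: W (x k)) ->
  exists l, [/\ W l = 0, weak_cvg ip x l, bounded_seq x &
                ip (W (x k)) (W (x k)) @[k --> \oo] --> 0].
Proof.
move=> Wc /andP[k0 kc] Wz0 xE; have c0 : 0 < c by lra.
pose phi z k := ip (x k - z) (x k - z).
have fejer z k : W z = 0 ->
    phi z k.+1 <= phi z k - kappa * (2 * c - kappa) * ip (W (x k)) (W (x k)).
  move=> Wz; have := Wc (x k) z; rewrite /phi xE Wz !subr0.
  rewrite !(ipE ip) !(ipC ip (W (x k))); nra.
have kc0 : 0 < kappa * (2 * c - kappa) by rewrite mulr_gt0 // subr_gt0.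
have phi0 z k : 0 <= phi z k by exact: (ip_ge0 ip_norm).
have phiS z k : W z = 0 -> phi z k.+1 <= phi z k.
  move=> /(fejer _ k) /le_trans; apply; rewrite gerBl.
  by rewrite mulr_ge0 ?(ltW kc0) // (ip_ge0 ip_norm).
have phi_mono z : W z = 0 -> {homo phi z : n m / (n <= m)%N >-> m <= n}.
  by move=> Wz; apply/nonincreasing_seqP => k; exact: phiS.
have phi_cvg z : W z = 0 -> cvgn (phi z).
  move=> Wz; apply: nonincreasing_is_cvgn; first exact: phi_mono.
  by exists 0 => _ [k _ <-].
(* By [fejer], |W x_k|^2 is at most a constant times the decrement of the convergent sequence
   [phi z0]. *)
have Wx0 : ip (W (x k)) (W (x k)) @[k --> \oo] --> 0.
  have lim0 : (kappa * (2 * c - kappa))^-1 * (phi z0 k - phi z0 k.+1)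
      @[k --> \oo] --> 0.
    rewrite -[X in _ --> X](mulr0 (kappa * (2 * c - kappa))^-1); apply: cvgMl_tmp.
    rewrite -(subrr (limn (phi z0))); have phiz0 := phi_cvg _ Wz0.
    by apply: cvgB => //; rewrite (cvg_shiftS (phi z0)).
  apply: (squeeze_cvgr _ (cvg_cst 0) lim0); apply: nearW => k.
  rewrite (ip_ge0 ip_norm) /= mulrC ler_pdivlMr // mulrC.
  by have := fejer z0 k Wz0; lra.
have xb : bounded_seq x.
  exists (`|x 0%N - z0| + `|z0|) => k; rewrite -[x k](subrK z0).
  apply: (le_trans (ler_normD _ _)); rewrite lerD2r.
  by rewrite -(@ler_pXn2r _ 2) ?nnegrE // -!ip_norm; exact: (phi_mono z0).
have Wlip y z : `|W y - W z| <= c^-1 * `|y - z|.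
  rewrite mulrC ler_pdivlMr //; have := Wc y z; rewrite ip_norm.
  have := le_trans (ler_norm _) (cauchy_schwarz ip_norm (y - z) (W y - W z)).
  have := normr_ge0 (W y - W z); have := normr_ge0 (y - z).
  rewrite le_eqVlt => /orP[/eqP<-|yz0]; nra.
have cluster0 S p : weak_cluster x S p -> W p = 0.
  move=> xp.
  (* Monotonicity bounds -<x_k, W z> below by f k, whose term in W x_k vanishes in the limit. *)
  have minty_ineq z : 0 <= ip (z - p) (W z).
    pose f k := - ip z (W z) + ip (z - x k) (W (x k)).
    have f0 : f k @[k --> \oo] --> - ip z (W z) + 0.
      apply: cvgD; first exact: cvg_cst.
      apply: cvg0_ip_bounded Wx0; case: xb => M xM; exists (`|z| + M) => k.
      by apply: (le_trans (ler_normB _ _)); rewrite lerD2l.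
    have := weak_cluster_le (y := - W z) xp f0; rewrite !(ipE ip) addr0.
    have h k : f k <= ip (x k) (- W z).
      have := Wc z (x k); have := ip_ge0 ip_norm (W z - W (x k)).
      by rewrite /f !(ipE ip); nra.
    by move=> /(_ h); lra.
  (* W is 1/c-Lipschitz, so the step c/2 keeps V within |W p| / 2 of W p, while <W p, V> <= 0; this
     forces W p = 0. *)
  have := minty_ineq (p - (c / 2) *: W p); rewrite (addrC p) addrK addrC.
  have := Wlip (p - (c / 2) *: W p) p; rewrite (addrC p) addrK.
  move: (W (- _ + p)) => V; rewrite normrN normrZ gtr0_norm ?divr_gt0 // mulrA.
  rewrite [_^-1 * _](_ : _ = 2^-1); last by field; rewrite gt_eqF.
  rewrite -(@ler_pXn2r _ 2) ?nnegrE ?mulr_ge0 ?invr_ge0 // exprMn -!ip_norm.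
  rewrite !(ipE ip) (ipC ip V) => h1.
  rewrite oppr_ge0 pmulr_rle0 ?divr_gt0 // => h2.
  by apply: (ip_eq0 ip_norm); have := ip_ge0 ip_norm V; lra.
have uniq S S' p p' : weak_cluster x S p -> weak_cluster x S' p' -> p = p'.
  move=> xp xp'.
  (* This inner product is an affine function of [phi p] - [phi p'], so it converges along the whole
     sequence and takes the same value at p and p'. *)
  have [L xL] : exists L : R, ip (x k) (p' - p) @[k --> \oo] --> L.
    have phip := phi_cvg p (cluster0 _ _ xp).
    have phip' := phi_cvg p' (cluster0 _ _ xp').
    exists (2^-1 * (limn (phi p) - limn (phi p') + (ip p' p' - ip p p))).
    rewrite (_ : (fun k => _) =
        fun k => 2^-1 * (phi p k - phi p' k + (ip p' p' - ip p p))).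
      by apply: cvgMl_tmp; apply: cvgD; [exact: cvgB | exact: cvg_cst].
    apply/funext => k; rewrite /phi !(ipE ip) !(ipC ip p (x k)) !(ipC ip p' (x k)).
    by field.
  have := weak_cluster_lim xp xL; have := weak_cluster_lim xp' xL => <- pp'.
  apply/esym/eqP; rewrite -subr_eq0; apply/eqP; apply: (ip_eq0 ip_norm).
  by rewrite (linearBl ip) /= pp' subrr.
have [|l xl] := @bounded_weak_cluster x setT xb; first by move=> n; exists n.
exists l; split=> //; first exact: cluster0 xl.
by apply: weak_cvg_cluster => // S p _ xp; exact: uniq xp xl.
Qed.

End WeakConvergence.

(** * Cocoercivity estimate and weak convergence of the shadows *)

Section AdaptiveDouglasRachford.
Variables (R : realType) (H : completeNormedModType R) (ip : {dot H for idfun}).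
Hypothesis ip_norm : forall x : H, ip x x = `|x| ^+ 2.
Variables alpha beta gamma delta : R.
Hypotheses (ab0 : 0 <= alpha + beta) (gamma0 : 0 < gamma) (delta0 : 0 < delta).

(* Completing the square in u turns the two comonotonicity inequalities into
   cocoercivity, and kappa_bar is the constant this produces; for
   alpha + beta = 0 the cross term <u, w> vanishes instead. *)
Lemma aDR_cocoercive (a u w : H) :
  gamma + delta <= 2 * (gamma + alpha) -> gamma + delta <= 2 * (delta + beta) ->
  alpha * ip u u <= ip a u ->
  beta * ip (delta^-1 *: w - u) (delta^-1 *: w - u) <=
    ip (a - w) (delta^-1 *: w - u) ->
  kappa_bar alpha beta gamma delta / 2 * ((gamma + delta) / delta) * ip w w <=
    ip (a + gamma *: u) w.
Proof.
move=> ga db h1 h2; have dN0 : delta != 0 by rewrite gt_eqF.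
have h3 : ip w w * (1 + beta / delta) + (gamma - delta - 2 * beta) * ip u w +
    delta * (alpha + beta) * ip u u <= ip (a + gamma *: u) w.
  have h4 := ler_wpM2l (ltW delta0) (lerD h1 h2).
  rewrite -subr_ge0; rewrite -subr_ge0 in h4; apply: le_trans h4 _.
  rewrite le_eqVlt; apply/orP; left; apply/eqP.
  rewrite !(ipE ip) (ipC ip w u); by field.
apply: le_trans h3; rewrite /kappa_bar; case: eqP => [ab|/eqP abN].
  (* With alpha = -beta, the two bounds on gamma + delta pin gamma - delta to 2 beta. *)
  have -> : gamma - delta - 2 * beta = 0 by lra.
  rewrite ab mulr0 !mul0r !addr0 (_ : beta = (gamma - delta) / 2); last by lra.
  rewrite le_eqVlt; apply/orP; left; apply/eqP.
  by field.
have abp : 0 < alpha + beta by rewrite lt_def abN.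
have gd : gamma + delta != 0 by rewrite gt_eqF // addr_gt0.
have c0 : 0 <= (4 * delta * (alpha + beta))^-1 by rewrite invr_ge0 !mulr_ge0 // ltW.
have := mulr_ge0 c0 (ip_ge0 ip_norm ((2 * delta * (alpha + beta)) *: u +
  (gamma - delta - 2 * beta) *: w)).
rewrite -(subr_ge0 (_ * ip w w)) => /le_trans; apply.
rewrite le_eqVlt; apply/orP; left; apply/eqP.
rewrite !(ipE ip) (ipC ip w u); field.
by rewrite abN gd dN0.
Qed.

Lemma bounded_seqD (x y : nat -> H) :
  bounded_seq x -> bounded_seq y -> bounded_seq (fun k => x k + y k).
Proof.
move=> [M xM] [M' yM]; exists (M + M') => k.
by apply: (le_trans (ler_normD _ _)); apply: lerD.
Qed.

Lemma bounded_seqZ c (x : nat -> H) :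
  bounded_seq x -> bounded_seq (fun k => c *: x k).
Proof. by move=> [M xM]; exists (`|c| * M) => k; rewrite normrZ ler_wpM2l. Qed.

Lemma bounded_seq_cst (c : H) : bounded_seq (fun=> c).
Proof. by exists `|c|. Qed.

Lemma shadow_weak_cvg (A B : H -> set H) (x u w : nat -> H) l u' :
  max_comonotone ip alpha A -> max_comonotone ip beta B ->
  0 < gamma + alpha -> 0 < delta + beta ->
  (forall k, A (x k - gamma *: u k) (u k)) ->
  (forall k, B (x k - gamma *: u k - w k) (delta^-1 *: w k - u k)) ->
  weak_cvg ip x l -> bounded_seq x -> bounded_seq u ->
  ip (w k) (w k) @[k --> \oo] --> 0 ->
  A (l - gamma *: u') u' -> weak_cvg ip u u'.
Proof.
move=> [Amon _] Bmax ga db Ak Bk xl xb ub w0 Al.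
apply: (weak_cvg_cluster ip_norm ub) => S p _ up.
(* Since R_1 x_k = x_k - gamma u_k - delta u_k, the point l - gamma p - delta p is its weak cluster
   value; B is resolved there. *)
have [b' [v' [Bb' b'E]]] := minty ip_norm (l - gamma *: p - delta *: p) Bmax db.
have {}b'E : b' = l - gamma *: p - delta *: p - delta *: v' by rewrite b'E addrK.
pose a' := l - gamma *: u'.
(* Y, X, C and [err] collect the terms in u_k, in x_k, constant, and in w_k of the summed
   inequalities, after (alpha + beta) |u_k - p|^2 has cancelled the quadratic term in u_k. *)
pose Y := gamma *: u' - a' + gamma *: v' + b' + (2 * alpha) *: u' -
  (2 * beta) *: v' - (2 * (alpha + beta)) *: p.
pose X := - u' - v'.
pose C := ip a' u' + ip b' v' - alpha * ip u' u' - beta * ip v' v' +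
  (alpha + beta) * ip p p.
pose err k := delta^-1 * ip (x k + (- gamma) *: u k + (- b')) (w k) +
  (1 + 2 * beta / delta) * ip (u k + v') (w k) -
  (delta^-1 + beta / delta ^+ 2) * ip (w k) (w k).
have err0 : err k @[k --> \oo] --> 0.
  rewrite (_ : 0 = delta^-1 * 0 + (1 + 2 * beta / delta) * 0 -
    (delta^-1 + beta / delta ^+ 2) * 0); last by rewrite !mulr0 subr0 addr0.
  apply: cvgB; last exact: cvgMl_tmp.
  apply: cvgD; apply: cvgMl_tmp; apply: (cvg0_ip_bounded ip_norm) => //.
    apply: bounded_seqD; last exact: bounded_seq_cst.
    by apply: bounded_seqD => //; exact: bounded_seqZ.
  by apply: bounded_seqD => //; exact: bounded_seq_cst.
pose f k := - C - ip (x k) X - err k.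
have fl : f k @[k --> \oo] --> - C - ip l X - 0.
  apply: cvgB => //; apply: cvgB; first exact: cvg_cst.
  exact: xl.
have fY k : f k <= ip (u k) Y.
  have := Amon _ _ _ _ (Ak k) Al; have := Bmax.1 _ _ _ _ (Bk k) Bb'.
  rewrite -!ip_norm -subr_ge0 => h2; rewrite -subr_ge0 => h1.
  have h3 := mulr_ge0 ab0 (ip_ge0 ip_norm (u k - p)).
  have h := addr_ge0 (addr_ge0 h1 h2) h3.
  rewrite -subr_ge0; apply: le_trans h _.
  rewrite le_eqVlt; apply/orP; left; apply/eqP.
  rewrite /f /C /err /Y /X /a' !(ipE ip).
  rewrite ?(ipC ip (u k) (x k)) ?(ipC ip (w k) (x k)) ?(ipC ip (w k) (u k))
    ?(ipC ip l (x k)) ?(ipC ip u' (x k)) ?(ipC ip b' (x k))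
    ?(ipC ip v' (x k)) ?(ipC ip p (x k))
    ?(ipC ip l (u k)) ?(ipC ip u' (u k)) ?(ipC ip b' (u k))
    ?(ipC ip v' (u k)) ?(ipC ip p (u k))
    ?(ipC ip l (w k)) ?(ipC ip u' (w k)) ?(ipC ip b' (w k))
    ?(ipC ip v' (w k)) ?(ipC ip p (w k))
    ?(ipC ip u' l) ?(ipC ip v' b').
  by field; rewrite gt_eqF.
have := weak_cluster_le up fl fY.
rewrite subr0 /C /X /Y /a' b'E => h.
suff /(ip_eq0 ip_norm)/eqP : ip (p - u') (p - u') <= 0.
  by rewrite subr_eq0 => /eqP.
have hp := ip_ge0 ip_norm (p - u'); have hv := ip_ge0 ip_norm (p + v').
(* By the choice of b', the limit inequality is exactly this one. *)
have : (gamma + alpha) * ip (p - u') (p - u') +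
    (delta + beta) * ip (p + v') (p + v') <= 0.
  rewrite -subr_ge0 in h; rewrite -oppr_ge0; apply: le_trans h _.
  rewrite le_eqVlt; apply/orP; left; apply/eqP.
  rewrite !(ipE ip).
  rewrite ?(ipC ip p l) ?(ipC ip u' l) ?(ipC ip v' l)
    ?(ipC ip u' p) ?(ipC ip v' p) ?(ipC ip v' u').
  by ring.
nra.
Qed.

End AdaptiveDouglasRachford.

(** * The adaptive operator as a Krasnoselskii-Mann step, and its shadows *)

Theorem theorem4p2 (R : realType) (H : completeNormedModType R)
    (ip : {dot H for idfun}) (ip_norm : forall x : H, ip x x = `|x| ^+ 2)
    (alpha beta : R) (A B : H -> set H)
    (gamma delta lambda mu kappa : R) (x0 : H) (x : nat -> H) :
  alpha + beta >= 0 ->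
  max_comonotone ip alpha A -> max_comonotone ip beta B ->
  zer (add_op A B) !=set0 ->
  0 < gamma -> 0 < delta -> 0 < lambda -> 0 < mu ->
  (lambda - 1) * (mu - 1) = 1 -> delta = (lambda - 1) * gamma ->
  gamma + delta <= Num.min (2 * (gamma + alpha)) (2 * (delta + beta)) ->
  0 < kappa < kappa_bar alpha beta gamma delta ->
  x 0%N = x0 ->
  (forall k, x k.+1 = T_aDR A B gamma delta lambda mu kappa (x k)) ->
  exists xstar : H,
    [/\ Fix (op_of (T_aDR A B gamma delta lambda mu kappa)) xstar,
        weak_cvg ip x xstar,
        weak_cvg ip (fun k => J_ gamma A (x k)) (J_ gamma A xstar) &
        zer (add_op A B) (J_ gamma A xstar)].
Proof.
move=> ab0 Amax Bmax [z [ua Az [ub Bz uab]]] g0 d0 l0 m0 lm dE.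
rewrite le_min => /andP[hga hdb] /andP[k0 kk] _ xE.
have ga : 0 < gamma + alpha by lra.
have db : 0 < delta + beta by lra.
have mE : mu = (gamma + delta) / delta.
  have : delta * (mu - 1) = gamma by rewrite dE mulrAC lm mul1r.
  by move=> <-; field; rewrite gt_eqF.
(* Opaque names: a = J_1, u = (Id - J_1) / gamma, b = J_2 R_1 (R_1 = a - delta u by [rE]), w = a -
   b, W = mu w. *)
have [a aJ] : {a | forall y, J_ gamma A y = a y} by exists (J_ gamma A).
have [u uE] : {u | forall y, gamma^-1 *: (y - a y) = u y} by eexists.
have [b bJ] : {b | forall y, J_ delta B (a y - delta *: u y) = b y} by eexists.
have [w wE] : {w | forall y, a y - b y = w y} by eexists.
have [W WE] : {W | forall y, mu *: w y = W y} by eexists.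
have yE y : y = a y + gamma *: u y.
  by rewrite -uE scalerKV ?gt_eqF // addrC subrK.
have aE y : a y = y - gamma *: u y by rewrite {2}(yE y) addrK.
have rE y : relax lambda a y = a y - delta *: u y.
  apply: (ip_inj ip_norm) => t; have := congr1 (ip^~ t) (yE y).
  by rewrite /relax dE /= !(ipE ip) => ->; ring.
have Aa y : A (a y) (u y).
  by have := J_P ip_norm y Amax ga g0; rewrite aJ uE.
have bE y : b y = a y - w y by rewrite -wE opprB addrC subrK.
have Bb y : B (b y) (delta^-1 *: w y - u y).
  have := J_P ip_norm (a y - delta *: u y) Bmax db d0; rewrite bJ.
  congr (B _ _); apply: (ip_inj ip_norm) => t; rewrite bE !(ipE ip).
  by field; rewrite gt_eqF.
(* Since (mu - 1) delta = gamma, R_2 R_1 = a + gamma u - mu w = Id - W. *)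
have TE y : T_aDR A B gamma delta lambda mu kappa y = y - kappa *: W y.
  rewrite /T_aDR (funext aJ) {1}/relax /= {1}/relax rE bJ bE -WE mE.
  apply: (ip_inj ip_norm) => t; have := congr1 (ip^~ t) (yE y).
  rewrite /= !(ipE ip) => ->.
  by field; rewrite gt_eqF.
have Wcoc y t : kappa_bar alpha beta gamma delta / 2 * ip (W y - W t) (W y - W t) <=
    ip (y - t) (W y - W t).
  have yt : y - t = a y - a t + gamma *: (u y - u t).
    apply: (ip_inj ip_norm) => s; have := congr1 (ip^~ s) (yE y).
    by have := congr1 (ip^~ s) (yE t); rewrite /= !(ipE ip); lra.
  have -> : W y - W t = mu *: (w y - w t) by rewrite scalerBr !WE.
  rewrite yt; suff : kappa_bar alpha beta gamma delta / 2 * mu *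
      ip (w y - w t) (w y - w t) <=
      ip (a y - a t + gamma *: (u y - u t)) (w y - w t).
    move=> /(ler_wpM2l (ltW m0)); move: (w y - w t) (_ + _) => D V.
    by rewrite !(ipE ip); lra.
  rewrite mE; apply: (aDR_cocoercive ip_norm) => //.
    by rewrite (ip_norm (u y - u t)); exact: (Amax.1 _ _ _ _ (Aa y) (Aa t)).
  have -> : delta^-1 *: (w y - w t) - (u y - u t) =
      (delta^-1 *: w y - u y) - (delta^-1 *: w t - u t).
    by apply: (ip_inj ip_norm) => s; rewrite !(ipE ip); ring.
  have -> : a y - a t - (w y - w t) = b y - b t.
    by rewrite !bE; apply: (ip_inj ip_norm) => s; rewrite !(ipE ip); ring.
  by rewrite ip_norm; exact: (Bmax.1 _ _ _ _ (Bb y) (Bb t)).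
(* R_1 sends this point to z - delta ua = z + delta ub, which J_2 sends back to z. *)
have Wz : W (z + gamma *: ua) = 0.
  have az : a (z + gamma *: ua) = z by rewrite -aJ (J_eq ip_norm Amax).
  have bz : b (z + gamma *: ua) = z.
    rewrite -bJ -uE az addrAC subrr add0r scalerK ?gt_eqF // -scalerN.
    have -> : - ua = ub by apply/esym/eqP; rewrite -addr_eq0 addrC uab.
    exact: (J_eq ip_norm Bmax).
  by rewrite -WE -wE az bz subrr scaler0.
have kk2 : 0 < kappa < 2 * (kappa_bar alpha beta gamma delta / 2).
  by rewrite k0 mulrC divfK.
have [|l [Wl xl xb Wx0]] := krasnoselskii_mann ip_norm Wcoc kk2 Wz (x := x).
  by move=> k; rewrite xE TE.
have wl : w l = 0.
  by move/eqP: Wl; rewrite -WE scaler_eq0 (gt_eqF m0) => /eqP.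
(* Comonotonicity gives (gamma + alpha) |u y - u t|^2 <= <y - t, u y - u t>; this bounds the
   sequence u (x k). *)
have u_lip y t : (gamma + alpha) * `|u y - u t| <= `|y - t|.
  have := Amax.1 _ _ _ _ (Aa y) (Aa t); rewrite -ip_norm.
  have : ip (y - t) (u y - u t) = ip (a y - a t) (u y - u t) +
      gamma * ip (u y - u t) (u y - u t).
    rewrite -(ipE ip).1.2 -(ipE ip).1.1.1; congr (ip _ _).
    apply: (ip_inj ip_norm) => s; have := congr1 (ip^~ s) (yE y).
    by have := congr1 (ip^~ s) (yE t); rewrite /= !(ipE ip); lra.
  have := le_trans (ler_norm _) (cauchy_schwarz ip_norm (y - t) (u y - u t)).
  rewrite ip_norm; have := normr_ge0 (u y - u t); have := normr_ge0 (y - t).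
  rewrite (le_eqVlt 0 `|u y - u t|) => yt /orP[/eqP<-|ut]; nra.
have ub' : bounded_seq (u \o x).
  have [M xM] := xb; exists ((gamma + alpha)^-1 * (M + `|l|) + `|u l|) => k.
  rewrite -[(u \o x) k](subrK (u l)); apply: (le_trans (ler_normD _ _)).
  rewrite lerD2r mulrC ler_pdivlMr // mulrC; apply: (le_trans (u_lip _ _)).
  by apply: (le_trans (ler_normB _ _)); rewrite lerD2r.
have w0 : ip (w (x k)) (w (x k)) @[k --> \oo] --> 0.
  rewrite (_ : (fun k => _) = fun k => mu ^- 2 * ip (W (x k)) (W (x k))).
    by rewrite -[X in _ --> X](mulr0 (mu ^- 2)); apply: cvgMl_tmp.
  by apply/funext => k; rewrite -WE !(ipE ip); field; rewrite gt_eqF.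
have ul : weak_cvg ip (u \o x) (u l).
  apply: (shadow_weak_cvg (w := w \o x) ip_norm ab0 d0 Amax Bmax ga db
    _ _ xl xb ub' w0).
  - by move=> k; rewrite /= -aE; exact: Aa.
  - by move=> k; rewrite /= -aE -bE; exact: Bb.
  - by rewrite -aE; exact: Aa.
exists l; split => //.
- by rewrite /Fix /op_of /= TE Wl scaler0 subr0.
- move=> y; rewrite aJ aE !(ipE ip).
  have -> : (fun k => ip (J_ gamma A (x k)) y) =
      fun k => ip (x k) y + - (gamma * ip (u (x k)) y).
    by apply/funext => k; rewrite aJ aE !(ipE ip).
  by apply: cvgD; [exact: xl | apply: cvgN; apply: cvgMl_tmp; exact: ul].
(* As w l = 0, both resolvents meet at a l, where A contains u l and B contains -u l. *)
- rewrite aJ; exists (u l); first exact: Aa.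
  exists (- u l); last by rewrite subrr.
  by have := Bb l; rewrite bE wl subr0 scaler0 sub0r.
Qed.
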